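(* Let $\mathbb{D}:\mathbb{R}^p\to\mathbb{R}$ be a non-negative convex function with $\mathbb{D}(0)=0$ that is superlinear, i.e. $\mathbb{D}(u)/\|u\|\to\infty$ as $\|u\|\to\infty$. Let $\Theta^\star=\mathbb{R}^p$ (no constraint, so $\mathbb{X}\equiv0$), and let $Y$ be a mean zero, absolutely continuous, centrally (resp. spherically, sign) symmetric random vector in $\mathbb{R}^p$ whose law dominates the Lebesgue measure on $\mathbb{R}^p$. Let $W$ be the (almost surely unique) minimizer over $u\in\mathbb{R}^p$ of $\mathbb{Z}(u)=\mathbb{D}(u)+\langle u,Y\rangle$. Then $W$ is centrally (resp. spherically, sign) symmetric if and only if $u\mapsto\mathbb{D}(u)+\mathbb{X}(u)=\mathbb{D}(u)$ is an even function, i.e. $\mathbb{D}(-u)=\mathbb{D}(u)$ for all $u\in\mathbb{R}^p$.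
   Context: A random vector $V$ in $\mathbb{R}^p$ is centrally symmetric if $V\overset{d}{=}-V$; spherically symmetric if $OV\overset{d}{=}V$ for every orthogonal $p\times p$ matrix $O$; sign symmetric if $(s_1V^{(1)},\ldots,s_pV^{(p)})\overset{d}{=}V$ for all $s_1,\ldots,s_p\in\{-1,1\}$. The law of $Y$ dominates Lebesgue measure if every Borel set of $P_Y$-measure zero has Lebesgue measure zero.
   Formalization: In the spherical (resp. sign) case, ''D even'' is replaced by D invariant under all orthogonal maps (resp. sign changes): evenness alone does not suffice, e.g. Y standard normal in R^2 with D(u)=u1^2+2u2^2 (resp. u1^2+u2^2+u1u2). *)

(* Defs.v *)
From HB Require Import structures.
From mathcomp Require Import all_boot all_order all_algebra.
From mathcomp Require Import all_classical all_reals all_analysis.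
From mathcomp Require Import measurable_realfun.
Set Implicit Arguments.
Unset Strict Implicit.
Unset Printing Implicit Defensive.
Import Order.TTheory GRing.Theory Num.Theory.
Import numFieldNormedType.Exports.
Local Open Scope classical_set_scope.
Local Open Scope ring_scope.

Definition borel_mx_display : measure_display.
Proof. exact. Qed.

Section borel_mx.
Context {R : realType} {m n : nat}.

Definition borel_mx : set (set 'M[R]_(m, n)) := <<s @open 'M[R]_(m, n) >>.

Let borel_mx0 : borel_mx set0.
Proof. exact: sigma_algebra0. Qed.

Let borel_mxC A : borel_mx A -> borel_mx (~` A).
Proof. exact: sigma_algebraC. Qed.

Let borel_mx_bigcup (F : (set 'M[R]_(m, n))^nat) :
  (forall i, borel_mx (F i)) -> borel_mx (\bigcup_i F i).
Proof. exact: sigma_algebra_bigcup. Qed.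

HB.instance Definition _ := @isMeasurable.Build borel_mx_display
  'M[R]_(m, n) borel_mx borel_mx0 borel_mxC borel_mx_bigcup.

End borel_mx.

Section borel_mx_theory.
Context {R : realType} {n : nat}.

Lemma measurable_coord (i : 'I_n) :
  measurable_fun [set: 'rV[R]_n] (fun v : 'rV[R]_n => v 0 i).
Proof.
apply: (measurability _ (RGenOpens.measurableE R)).
move=> _ [_ [x [y ->]] <-]; rewrite setTI; apply: sub_sigma_algebra.
by apply: open_comp => [v _|]; [exact: coord_continuous|exact: itv_open].
Qed.

Lemma measurable_fun_rVP d (T : measurableType d) (f : T -> 'rV[R]_n) :
  (forall i, measurable_fun [set: T] (fun x => f x 0 i)) ->
  measurable_fun [set: T] f.
Proof.
move=> mf.
apply: (@measurability _ _ _ _ _ _ (@open 'rV[R]_n)) => // _ [U oU <-]; rewrite setTI.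
pose B (q : 'rV[rat]_n * rat) : set 'rV[R]_n :=
  [set v | forall i, ball (ratr (q.1 0 i) : R) (ratr q.2) (v 0 i)].
have -> : f @^-1` U = \bigcup_(q in [set q | B q `<=` U]) f @^-1` (B q).
  apply/seteqP; split=> [x Ufx|x [q /= qU Bqx]]; last exact: qU.
  have /nbhs_ballP[e /= e0 eU] : nbhs (f x) U by exact: open_nbhs_nbhs.
  have [r /itvP r0e] : exists r : rat, ratr r \in `]0, (e / 2)[.
    by apply: rat_in_itvoo; rewrite divr_gt0.
  have /all_sig[q qP] : forall i, {q : rat | ball (f x 0 i) (ratr r) (ratr q)}.
    move=> i; apply: cid.
    have [y [fxy [q _ qy]]] : ball (f x 0 i) (ratr r) `&` range (@ratr R) !=set0.
      apply: dense_rat; last exact: ball_open.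
      by exists (f x 0 i); apply: ballxx; rewrite r0e.
    by exists q; rewrite qy.
  exists (\row_i q i, r) => [v /= Bv|i] /=.
    apply: eU; split => // j i; rewrite (ord1 j).
    have := Bv i; rewrite mxE => /(ball_triangle (qP i)).
    apply: le_ball; rewrite [leRHS](splitr e).
    by rewrite lerD// ltW// r0e.
  by rewrite mxE; apply: ball_sym.
rewrite bigcup_mkcond.
apply: countable_bigcupT_measurable => // q.
case: ifP => // _.
rewrite (_ : _ @^-1` _ = \bigcap_(i in [set: 'I_n])
   (fun x => f x 0 i) @^-1` ball (ratr (q.1 0 i) : R) (ratr q.2)); last first.
  by apply/seteqP; split=> [x Bx i _|x Bx i]; exact: Bx.
apply: fin_bigcap_measurable; first exact: finite_finset.
move=> i _; rewrite -[X in measurable X]setTI; apply: mf => //.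
exact: measurable_ball.
Qed.

End borel_mx_theory.

Section lebesgue_rV.
Context {R : realType}.

Definition rV_cons n (xv : measurableTypeR R * 'rV[R]_n) : 'rV[R]_n.+1 :=
  row_mx (xv.1)%:M xv.2.

Definition rV_uncons n (v : 'rV[R]_n.+1) : measurableTypeR R * 'rV[R]_n :=
  (v 0 0, \row_i v 0 (lift 0 i)).

Lemma rV_cons0 n (xv : measurableTypeR R * 'rV[R]_n) : rV_cons xv 0 0 = xv.1.
Proof.
have := row_mxEl (xv.1%:M : 'M[R]_1) xv.2 0 0.
rewrite [RHS]mxE eqxx mulr1n => <-.
by apply: congr1; exact/val_inj.
Qed.

Lemma rV_consS n (xv : measurableTypeR R * 'rV[R]_n) (i : 'I_n) :
  rV_cons xv 0 (lift 0 i) = xv.2 0 i.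
Proof.
rewrite -(row_mxEr (xv.1%:M : 'M[R]_1) xv.2).
by apply: congr1; exact/val_inj.
Qed.

Lemma rV_consK n : cancel (@rV_cons n) (@rV_uncons n).
Proof.
move=> [x v]; rewrite /rV_uncons rV_cons0; congr (_, _).
by apply/rowP => i; rewrite mxE rV_consS.
Qed.

Lemma measurable_rV_cons n : measurable_fun setT (@rV_cons n).
Proof.
apply: measurable_fun_rVP => i.
case: (unliftP 0 i) => [j|] ->.
  under eq_fun do rewrite rV_consS.
  exact: (measurableT_comp (measurable_coord j)).
under eq_fun do rewrite rV_cons0.
exact: measurable_fst.
Qed.

HB.instance Definition _ n := @isMeasurableFun.Build _ _ _ _ (@rV_cons n)
  (@measurable_rV_cons n).

Lemma measurable_rV_uncons n : measurable_fun setT (@rV_uncons n).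
Proof.
apply/measurable_fun_pairP; split; first exact: measurable_coord.
apply: measurable_fun_rVP => i; apply: eq_measurable_fun; last first.
  exact: (measurable_coord (lift 0 i)).
by move=> v _; rewrite /= mxE.
Qed.

Section lebesgue_cons.
Context n (mu : {sigma_finite_measure set 'rV[R]_n -> \bar R}).

Definition lebesgue_cons : set 'rV[R]_n.+1 -> \bar R :=
  pushforward (@lebesgue_measure R \x mu)%E (@rV_cons n).

Let lebesgue_cons0 : lebesgue_cons set0 = 0%E.
Proof. exact: measure0. Qed.

Let lebesgue_cons_ge0 A : (0 <= lebesgue_cons A)%E.
Proof. exact: measure_ge0. Qed.

Let lebesgue_cons_sigma_additive : semi_sigma_additive lebesgue_cons.
Proof.
apply: measure_semi_sigma_additive; exact: measurable_rV_cons.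
Qed.

HB.instance Definition _ := isMeasure.Build _ _ _ lebesgue_cons
  lebesgue_cons0 lebesgue_cons_ge0 lebesgue_cons_sigma_additive.

Let lebesgue_cons_sigma_finite : sigma_finite setT lebesgue_cons.
Proof.
have /sigma_finiteP[F [FT ndF Foo]] := sigma_finiteT (@lebesgue_measure R).
have /sigma_finiteP[G [GT ndG Goo]] := sigma_finiteT mu.
exists (fun k => @rV_uncons n @^-1` (F k `*` G k)) => [|k].
  apply/esym/seteqP; split=> // v _.
  have [i _ Fi] : (\bigcup_i F i) (rV_uncons v).1 by rewrite -FT.
  have [j _ Gj] : (\bigcup_i G i) (rV_uncons v).2 by rewrite -GT.
  exists (maxn i j) => //; split.
    by move: Fi; exact/subsetPset/ndF/leq_maxl.
  by move: Gj; exact/subsetPset/ndG/leq_maxr.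
have [[mF Fk] [mG Gk]] := (Foo k, Goo k); split.
  rewrite -[X in measurable X]setTI; apply: measurable_rV_uncons => //.
  exact: measurableX.
rewrite /lebesgue_cons /pushforward -comp_preimage.
rewrite (_ : _ \o _ = id); last by apply/funext => xv; exact: rV_consK.
by rewrite preimage_id product_measure1E// lte_mul_pinfty// ge0_fin_numE.
Qed.

HB.instance Definition _ := Measure_isSigmaFinite.Build _ _ _
  lebesgue_cons lebesgue_cons_sigma_finite.

End lebesgue_cons.

(* p-fold product of the one-dimensional Lebesgue measure *)
Fixpoint lebesgue_rV (p : nat) : {sigma_finite_measure set 'rV[R]_p -> \bar R} :=
  match p with
  | 0 => \d_(0 : 'rV[R]_0)
  | n.+1 => lebesgue_cons (lebesgue_rV n)
  end.

End lebesgue_rV.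

Lemma lebesgue_rV_box (R : realType) p (A : 'I_p -> set (measurableTypeR R)) :
  (forall i, measurable (A i)) ->
  lebesgue_rV p [set v : 'rV[R]_p | forall i, A i (v 0 i)] =
  (\prod_(i < p) lebesgue_measure (A i))%E.
Proof.
elim: p A => [|p IH] A mA.
  by rewrite big_ord0 /= diracE mem_set// => i; case: i (ltn_ord i).
rewrite big_ord_recl -IH//= /lebesgue_cons /pushforward.
rewrite (_ : _ @^-1` _ =
    A ord0 `*` [set v : 'rV[R]_p | forall i, A (lift ord0 i) (v 0 i)]).
  rewrite product_measure1E//.
  rewrite (_ : [set v | _] = \bigcap_(i in [set: 'I_p])
      (fun v : 'rV[R]_p => v 0 i) @^-1` A (lift ord0 i)); last first.
    by apply/seteqP; split=> [v Av i _|v Av i]; exact: Av.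
  apply: fin_bigcap_measurable => [|i _]; first exact: finite_finset.
  by rewrite -[X in measurable X]setTI; apply: (measurable_coord i) => //; exact: mA.
apply/seteqP; split=> [xv Axv|xv [A0 AS] i].
  split=> [|i]; first by have := Axv ord0; rewrite rV_cons0.
  by have := Axv (lift ord0 i); rewrite rV_consS.
by case: (unliftP ord0 i) => [j|] ->; rewrite ?rV_cons0 ?rV_consS//; exact: AS.
Qed.

Section euclidean.
Context {R : realType} {p : nat}.
Implicit Types (u v y : 'rV[R]_p) (f D : 'rV[R]_p -> R).

Definition dotv u v : R := \sum_(i < p) u 0 i * v 0 i.

(* the canonical norm `|u| on 'rV[R]_p is the sup norm *)
Definition enorm u : R := Num.sqrt (dotv u u).

Definition superlinear D :=
  forall M : R, exists r : R, forall u, r < enorm u -> M < D u / enorm u.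

Definition is_minimizer f u := forall v, f u <= f v.

Definition objective D y u : R := D u + dotv u y.

Definition orthogonal_mx (O : 'M[R]_p) := O *m O^T = 1%:M.

(* vectors are rows, so that the column vector O u is the row u O^T *)
Definition rotate (O : 'M[R]_p) u : 'rV[R]_p := u *m O^T.

Definition sign_vector (s : 'I_p -> R) := forall i, s i = 1 \/ s i = -1.

Definition flip (s : 'I_p -> R) u : 'rV[R]_p := \row_i (s i * u 0 i).

Definition even_function D := forall u, D (- u) = D u.

Definition rotation_invariant D :=
  forall O, orthogonal_mx O -> forall u, D (rotate O u) = D u.

Definition sign_invariant D :=
  forall s, sign_vector s -> forall u, D (flip s u) = D u.

End euclidean.

Section symmetry.
Context d (T : measurableType d) (R : realType) (P : probability T R) (p : nat).
Implicit Types V : T -> 'rV[R]_p.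

Definition same_law V V' :=
  forall A, measurable A -> pushforward P V A = pushforward P V' A.

Definition centrally_symmetric V := same_law V (fun w => - V w).

Definition spherically_symmetric V :=
  forall O, orthogonal_mx O -> same_law (fun w => rotate O (V w)) V.

Definition sign_symmetric V :=
  forall s, sign_vector s -> same_law (fun w => flip s (V w)) V.

Definition mean_zero V := forall i,
  P.-integrable [set: T] (fun w => (V w 0 i)%:E) /\
  ('E_P[fun w => (V w 0 i)%R] = 0)%E.

End symmetry.

(* Main.v *)
Require Import Defs.
From HB Require Import structures.
From mathcomp Require Import all_boot all_order all_algebra.
From mathcomp Require Import all_classical all_reals all_analysis.
From mathcomp Require Import measurable_realfun ring lra.
Set Implicit Arguments.
Unset Strict Implicit.
Unset Printing Implicit Defensive.
Import Order.TTheory GRing.Theory Num.Theory.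
Import numFieldNormedType.Exports.
Local Open Scope classical_set_scope.
Local Open Scope ring_scope.

(** Write [g_D(y) = min_u (D u + <u, y>)].  All three symmetries are instances
of invariance under one orthogonal matrix [O], and [O W] minimizes the objective
of [D' = D o O^T] at [O Y].

Uniqueness: two minimizers at [y] are separated by a slab [q < u_i < r] with
rational bounds, so the minima over [u_i <= q] and [u_i >= r] agree at [y].
Moving along the [i]-th axis changes these two minima at different speeds, hence
every line in that direction carries at most one such [y], and Fubini applies.

If [D' = D], the event [W in U] with [U] open is, up to a null set, the event
that the minimum over the complement of [U] exceeds the global one; it only
depends on the law of [Y].

Conversely, put [F = D - D'] and [G = g_D - g_D'].  Then [F(W) <= G(Y)] and
[G(O Y) <= F(O W)], and the two outer terms have the same law, as have the two
inner ones; so [F(W) = G(Y)] almost surely, that is, [W] also minimizes the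
objective of [D'] at [Y].  By continuity and full support, [D] and [D'] share a
minimizer at every [y]; summing over a fine subdivision of a segment shows that
[G] is constant.  Finally convex functions are subdifferentiable on a dense set
(proximal points), so [D - D'] is constant, hence zero. *)

(** * Inner product, Euclidean norm and orthogonal maps *)

Section euclidean_space.
Context {R : realType} {p : nat}.
Implicit Types (u v y : 'rV[R]_p) (D : 'rV[R]_p -> R).

Lemma dotv_mulmx u v : dotv u v = (u *m v^T) 0 0.
Proof. by rewrite mxE; apply: eq_bigr => i _; rewrite mxE. Qed.

Lemma dotvC u v : dotv u v = dotv v u.
Proof. by apply: eq_bigr => i _; rewrite mulrC. Qed.

Lemma dotvDl u v y : dotv (u + v) y = dotv u y + dotv v y.
Proof. by rewrite !dotv_mulmx mulmxDl mxE. Qed.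

Lemma dotvZl (t : R) u y : dotv (t *: u) y = t * dotv u y.
Proof. by rewrite !dotv_mulmx -scalemxAl mxE. Qed.

Lemma dotv0l y : dotv 0 y = 0.
Proof. by rewrite dotv_mulmx mul0mx mxE. Qed.

Lemma dotvNl u y : dotv (- u) y = - dotv u y.
Proof. by rewrite -scaleN1r dotvZl mulN1r. Qed.

Lemma dotvBl u v y : dotv (u - v) y = dotv u y - dotv v y.
Proof. by rewrite dotvDl dotvNl. Qed.

Lemma dotvDr u v y : dotv y (u + v) = dotv y u + dotv y v.
Proof. by rewrite !(dotvC y) dotvDl. Qed.

Lemma dotvZr (t : R) u y : dotv y (t *: u) = t * dotv y u.
Proof. by rewrite !(dotvC y) dotvZl. Qed.

Lemma dotvNr u y : dotv y (- u) = - dotv y u.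
Proof. by rewrite !(dotvC y) dotvNl. Qed.

Definition dotv_linear := (dotvDl, dotvDr, dotvNl, dotvNr, dotvZl, dotvZr).

Lemma dotv_delta u (i : 'I_p) : dotv u (delta_mx 0 i) = u 0 i.
Proof.
rewrite /dotv (bigD1 i)//= mxE !eqxx mulr1 big1 ?addr0// => j ji.
by rewrite mxE (negbTE ji) andbF mulr0.
Qed.

Lemma dotv_ge0 u : 0 <= dotv u u.
Proof. by apply: sumr_ge0 => i _; rewrite -expr2 sqr_ge0. Qed.

Lemma sqr_coord_le_dotv u (i : 'I_p) : u 0 i ^+ 2 <= dotv u u.
Proof.
rewrite /dotv (bigD1 i)//= -expr2 lerDl sumr_ge0// => j _.
by rewrite -expr2 sqr_ge0.
Qed.

Lemma normr_coord_le_enorm u (i : 'I_p) : `|u 0 i| <= enorm u.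
Proof. by rewrite -sqrtr_sqr ler_wsqrtr ?sqr_coord_le_dotv. Qed.

Lemma normr_rV_le u (e : R) : 0 <= e ->
  `|u| <= e <-> forall i, `|u 0 i| <= e.
Proof.
move=> e0; rewrite [`|u|]mx_normrE; split => [/bigmax_leP[_ ue] i|ue].
  exact: (ue (0, i)).
by apply/bigmax_leP; split=> // -[i j] _ /=; rewrite (ord1 i).
Qed.

Lemma normr_le_enorm u : `|u| <= enorm u.
Proof.
by apply/normr_rV_le => [|i]; rewrite ?sqrtr_ge0 ?normr_coord_le_enorm.
Qed.

Lemma normr_dotv_le u y : `|dotv u y| <= enorm u * \sum_(i < p) `|y 0 i|.
Proof.
rewrite mulr_sumr (le_trans (ler_norm_sum _ _ _))// ler_sum// => i _.
by rewrite normrM ler_wpM2r// normr_coord_le_enorm.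
Qed.

Lemma rotateD (O : 'M[R]_p) u v : rotate O (u + v) = rotate O u + rotate O v.
Proof. exact: mulmxDl. Qed.

Lemma rotateZ (O : 'M[R]_p) (t : R) u : rotate O (t *: u) = t *: rotate O u.
Proof. by rewrite /rotate -scalemxAl. Qed.

Lemma rotate0 (O : 'M[R]_p) : rotate O 0 = 0.
Proof. exact: mul0mx. Qed.

Lemma orthogonal_trmx (O : 'M[R]_p) : orthogonal_mx O -> orthogonal_mx O^T.
Proof. by rewrite /orthogonal_mx trmxK => /mulmx1C. Qed.

Lemma rotateK (O : 'M[R]_p) : orthogonal_mx O ->
  cancel (rotate O) (rotate O^T).
Proof.
by move=> oO u; rewrite /rotate trmxK -mulmxA (mulmx1C oO) mulmx1.
Qed.

Lemma rotateTK (O : 'M[R]_p) : orthogonal_mx O ->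
  cancel (rotate O^T) (rotate O).
Proof. by move=> oO u; rewrite /rotate trmxK -mulmxA oO mulmx1. Qed.

Lemma dotv_rotate (O : 'M[R]_p) u v : orthogonal_mx O ->
  dotv (rotate O u) (rotate O v) = dotv u v.
Proof.
move=> oO; rewrite !dotv_mulmx /rotate trmx_mul trmxK.
by rewrite mulmxA -(mulmxA u) (mulmx1C oO) mulmx1.
Qed.

End euclidean_space.

(** * Finite convex functions and their continuity *)

Section convex_analysis.
Context {R : realType} {p : nat}.
Implicit Types (u v x y z : 'rV[R]_p) (D : 'rV[R]_p -> R) (A : set 'rV[R]_p).

(** The weights are plain reals with side conditions, unlike the interval-typed weights of
    [convex_function], so that linear arithmetic applies directly. *)
Definition convexf D := forall (t : R) u v, 0 <= t -> t <= 1 ->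
  D (t *: u + (1 - t) *: v) <= t * D u + (1 - t) * D v.

Lemma convexfP D : convex_function [set: convex_lmodType 'rV[R]_p] D ->
  convexf D.
Proof.
move=> cD t u v t0 t1.
have := cD (Itv01 t0 t1) u v; rewrite !inE => /(_ I I).
by rewrite convRE.
Qed.

Lemma convexfD D D' : convexf D -> convexf D' -> convexf (fun u => D u + D' u).
Proof.
move=> cD cD' t u v t0 t1; have := cD t u v t0 t1; have := cD' t u v t0 t1.
by lra.
Qed.

Lemma convexfZ D (c : R) : 0 <= c -> convexf D -> convexf (fun u => c * D u).
Proof.
move=> c0 cD t u v t0 t1; have := ler_wpM2l c0 (cD t u v t0 t1); lra.
Qed.

Lemma convexf_objective D y : convexf D -> convexf (objective D y).
Proof.
move=> cD t u v t0 t1; have := cD t u v t0 t1.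
by rewrite /objective !dotv_linear; lra.
Qed.

Lemma convexf_dotv (c : R) : 0 <= c -> convexf (fun u => c * dotv u u).
Proof.
move=> c0 t u v t0 t1; rewrite -subr_ge0.
have -> : t * (c * dotv u u) + (1 - t) * (c * dotv v v) -
  c * dotv (t *: u + (1 - t) *: v) (t *: u + (1 - t) *: v) =
  c * (t * (1 - t)) * dotv (u - v) (u - v).
  by rewrite !dotv_linear (dotvC v u); ring.
by rewrite mulr_ge0 ?dotv_ge0// !mulr_ge0// subr_ge0.
Qed.

Lemma convexf_rotate (O : 'M[R]_p) D : convexf D -> convexf (D \o rotate O).
Proof. by move=> cD t u v t0 t1 /=; rewrite rotateD !rotateZ; exact: cD. Qed.

(** Induction on the number [k] of free coordinates: a point of the cube lies on a segment joining
    two opposite faces, each a translated cube with one free coordinate fewer, so its value is at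
    most the larger of the two face bounds. For [k = p] this bounds [D] above on the unit ball of
    the sup norm. *)
Lemma convexf_cube_bound D (k : nat) : convexf D -> forall x, exists K : R,
  forall h : 'rV[R]_p, `|h| <= 1 -> (forall i : 'I_p, (k <= i)%N -> h 0 i = 0) ->
  D (x + h) <= K.
Proof.
move=> cD; elim: k => [x|k IH x].
  exists (D x) => h _ h0.
  by rewrite (_ : h = 0) ?addr0//; apply/rowP => i; rewrite h0// mxE.
have [kp|pk] := ltnP k p; last first.
  have [K KP] := IH x; exists K => h h1 h0; apply: KP => // i ki.
  by have := leq_trans pk ki; rewrite leqNgt ltn_ord.
set i0 := Ordinal kp; set e : 'rV[R]_p := delta_mx 0 i0.
have [[K1 K1P] [K2 K2P]] := (IH (x + e), IH (x - e)).
exists (Num.max K1 K2) => h h1 h0.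
have hi := (normr_rV_le h (@ler01 R)).1 h1.
set s := h 0 i0; set h' := h - s *: e.
have h'1 : `|h'| <= 1.
  apply/normr_rV_le => // i; rewrite !mxE eqxx /=.
  by case: eqVneq => [->|_]; rewrite ?mulr1 ?subrr ?normr0// mulr0 subr0.
have h'0 (i : 'I_p) : (k <= i)%N -> h' 0 i = 0.
  rewrite leq_eqVlt !mxE eqxx /= => /orP[/eqP ki|ki].
    rewrite (_ : i = i0) ?eqxx ?mulr1 ?subrr//.
    by apply: val_inj.
  by rewrite h0// (_ : i == i0 = false) ?mulr0 ?subr0// -val_eqE /= gtn_eqF.
have /andP[s1 s2] : -1 <= s <= 1 by rewrite -ler_norml hi.
have -> : x + h = ((1 + s) / 2) *: (x + e + h') +
                  (1 - (1 + s) / 2) *: (x - e + h').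
  by apply/rowP => i; rewrite !mxE; field.
apply: le_trans (cD _ _ _ _ _) _; [lra|lra|].
have a1 := K1P _ h'1 h'0; have a2 := K2P _ h'1 h'0.
set t := (1 + s) / 2.
have [t0 t1] : 0 <= t /\ t <= 1 by rewrite /t; split; lra.
rewrite (_ : Num.max K1 K2 = t * Num.max K1 K2 + (1 - t) * Num.max K1 K2);
  last by ring.
by rewrite lerD// ler_wpM2l ?subr_ge0// ?(le_trans a1) ?(le_trans a2)//
  le_max lexx ?orbT.
Qed.

(** The upper bound [K] on a ball around [x], contracted towards [x] by convexity, gives upper
    semicontinuity; reflection through [x] turns it into the lower estimate. *)
Lemma convexf_continuous D : convexf D -> continuous D.
Proof.
move=> cD; suff: forall x, D z @[z --> x] --> D x by [].
move=> x; apply/(@cvgrPdist_lt _ _ _ (nbhs x) (nbhs_filter x)) => e e0.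
have [K KP] := convexf_cube_bound p cD x.
have {}KP h : `|h| <= 1 -> D (x + h) <= K.
  by move=> h1; apply: KP => // i; rewrite leqNgt ltn_ord.
have DK : D x <= K by rewrite -[x]addr0 KP// normr0.
(* The ratio [t] serves as contraction factor and as radius; it is chosen so that
   [t * (K - D x) < e]. *)
set t := e / (e + (K - D x)).
have d0 : 0 < e + (K - D x) by lra.
have t0 : 0 < t by rewrite divr_gt0.
have t1 : t <= 1 by rewrite ler_pdivrMr// mul1r; lra.
have tK : t * (K - D x) < e.
  by rewrite /t mulrAC ltr_pdivrMr// ltr_pM2l//; lra.
have ub h : `|h| < t -> D (x + h) < D x + e.
  move=> ht; have -> : x + h = t *: (x + t^-1 *: h) + (1 - t) *: x.
    by apply/rowP => i; rewrite !mxE; field; rewrite gt_eqF.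
  apply: le_lt_trans (cD _ _ _ (ltW t0) t1) _.
  have : D (x + t^-1 *: h) <= K.
    by apply: KP; rewrite normrZ gtr0_norm ?invr_gt0// ler_pdivrMl// mulr1 ltW.
  rewrite -(ler_pM2l t0); lra.
apply/(@nbhs_normP R 'rV[R]_p x); exists t => //= z /= zt; rewrite distrC in zt.
have := ub (z - x) zt; have := ub (x - z); rewrite distrC => /(_ zt).
(* [x] is the midpoint of [z] and its reflection [x + (x - z)], and the upper bound holds at
   both. *)
have := cD 2^-1 (x + (z - x)) (x + (x - z)).
rewrite (_ : 2^-1 *: _ + _ = x); last first.
  by apply/rowP => i; rewrite !mxE; field.
move=> h0 h1 h2; have {}h0 := h0 ltac:(lra) ltac:(lra); move: h0 h1 h2.
rewrite (addrC x (z - x)) subrK ltr_norml => h1 h2 h3.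
by apply/andP; split; lra.
Qed.

End convex_analysis.

(** * Existence of minimizers and the minimal value as a function of [y] *)

Section minimization.
Context {R : realType} {p : nat}.
Implicit Types (u v x y z : 'rV[R]_p) (D : 'rV[R]_p -> R) (A : set 'rV[R]_p).

Lemma superlinear_coercive D y (c : R) : superlinear D ->
  exists r : R, forall u, r < enorm u -> c < objective D y u.
Proof.
move=> sD; set S := \sum_(i < p) `|y 0 i|.
(* The part [S] absorbs the linear term, leaving at least [|c|] times [enorm u]; the maximum with 1
   below makes this at least [c]. *)
have [r rP] := sD (S + `|c|).
exists (Num.max r 1) => u; rewrite gt_max => /andP[/rP ru u1].
have u0 : 0 < enorm u by rewrite (lt_trans ltr01).
move: ru; rewrite ltr_pdivlMr// => ru.
have := normr_dotv_le u y; rewrite -/S ler_norml => /andP[uS _].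
have : `|c| <= `|c| * enorm u by rewrite ler_peMr// ltW.
have := ler_norm c; rewrite /objective; lra.
Qed.

Lemma superlinearD D D' : (forall u, 0 <= D' u) ->
  superlinear D -> superlinear (fun u => D u + D' u).
Proof.
move=> D'0 sD M; have [r rP] := sD M; exists r => u /rP /lt_le_trans; apply.
by rewrite mulrDl lerDl divr_ge0// sqrtr_ge0.
Qed.

Lemma superlinearZ D (c : R) : 0 < c -> superlinear D ->
  superlinear (fun u => c * D u).
Proof.
move=> c0 sD M; have [r rP] := sD (M / c); exists r => u /rP.
by rewrite ltr_pdivrMr// mulrC mulrA.
Qed.

Lemma superlinear_rotate (O : 'M[R]_p) D : orthogonal_mx O ->
  superlinear D -> superlinear (D \o rotate O).
Proof.
move=> oO sD M; have [r rP] := sD M; exists r => u.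
by have := rP (rotate O u); rewrite /enorm dotv_rotate.
Qed.

Lemma exists_minimizer_on D A y : convexf D -> superlinear D ->
  closed A -> A !=set0 ->
  exists2 u, A u & forall v, A v -> objective D y u <= objective D y v.
Proof.
move=> cD sD clA [u0 Au0].
have [r rP] := superlinear_coercive y (objective D y u0) sD.
(* Outside this box the objective exceeds its value at [u0]; the radius is enlarged so that the box
   contains [u0] itself. *)
pose I0 := `[- Num.max r (enorm u0), Num.max r (enorm u0)]%classic.
pose K := A `&` [set u | forall i, I0 (u ord0 i)].
have cK : compact K.
  rewrite /K setIC; apply: compact_closedI => //.
  by apply: (@rV_compact R p (fun=> I0)) => _; exact: segment_compact.
have Kin v : A v -> enorm v <= Num.max r (enorm u0) -> K v.
  move=> Av vr; split=> // i; rewrite /I0 /= in_itv /= -ler_norml.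
  exact: le_trans (normr_coord_le_enorm _ _) vr.
have Ku0 : K u0 by apply: Kin => //; rewrite le_max lexx orbT.
have [||u Ku uP] := @compact_EVT_min _ R (objective D y) K _ cK.
- by exists u0.
- exact/continuous_subspaceT/convexf_continuous/convexf_objective.
exists u; first by move: Ku; rewrite inE => -[].
move=> v Av; have [vr|rv] := leP (enorm v) (Num.max r (enorm u0)).
  by apply: uP; rewrite inE; exact: Kin.
apply: (le_trans (uP u0 _)); first by rewrite inE.
by apply/ltW/rP; move: rv; rewrite gt_max => /andP[].
Qed.

(** For [A = setT] this is the function g_D. For [D] convex and superlinear and [A] closed and
    nonempty, the infimum is attained. *)
Definition minval A D y : R := inf [set objective D y u | u in A].

Lemma minval_eq A D y u : A u ->
  (forall v, A v -> objective D y u <= objective D y v) ->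
  minval A D y = objective D y u.
Proof.
move=> Au uP; apply/eqP; rewrite eq_le; apply/andP; split.
  apply: ge_inf; last by exists u.
  by exists (objective D y u) => _ [v Av <-]; exact: uP.
by apply: lb_le_inf => [|_ [v Av <-]]; [exists (objective D y u), u|exact: uP].
Qed.

Section minval_theory.
Variables (D : 'rV[R]_p -> R) (cD : convexf D) (sD : superlinear D).

Lemma minval_attained A y : closed A -> A !=set0 ->
  exists2 u, A u & minval A D y = objective D y u.
Proof.
move=> clA A0; have [u Au uP] := exists_minimizer_on y cD sD clA A0.
by exists u => //; exact: minval_eq.
Qed.

Lemma minval_le A y u : closed A -> A u -> minval A D y <= objective D y u.
Proof.
move=> clA Au; have A0 : A !=set0 by exists u.
have [v Av vP] := exists_minimizer_on y cD sD clA A0.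
by rewrite (minval_eq Av vP) vP.
Qed.

Lemma is_minimizerP y u :
  is_minimizer (objective D y) u <-> minval setT D y = objective D y u.
Proof.
split=> [uP|uE v]; first by apply: minval_eq.
by rewrite -uE; apply: minval_le => //; exact: closedT.
Qed.

Lemma minval_minimizer y u :
  is_minimizer (objective D y) u -> minval setT D y = objective D y u.
Proof. by move/is_minimizerP. Qed.

Lemma exists_minimizer y : exists u, is_minimizer (objective D y) u.
Proof.
have [|u _ /is_minimizerP uP] := minval_attained y (@closedT _).
  by exists 0.
by exists u.
Qed.

(** An infimum of functions affine in [y] is concave; the sign is chosen so that
    [convexf_continuous] applies. *)
Lemma minval_concave : convexf (fun y => - minval setT D y).
Proof.
move=> t y z t0 t1.
have [u uP] := exists_minimizer (t *: y + (1 - t) *: z).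
rewrite (minval_minimizer uP).
have hy := @minval_le setT y u (@closedT _) I.
have hz := @minval_le setT z u (@closedT _) I.
have t1' : 0 <= 1 - t by lra.
have := ler_wpM2l t0 hy; have := ler_wpM2l t1' hz.
by rewrite /objective !dotv_linear; lra.
Qed.

(** Moving [y] by [s] along axis [i] adds [s * u 0 i] to the objective, which is at most [s * q] on
    [A] and at least [s * r] on [A']. *)
Lemma minval_shift_lt A A' (i : 'I_p) (q r s : R) y :
  closed A -> A !=set0 -> closed A' -> A' !=set0 ->
  (forall u, A u -> u 0 i <= q) -> (forall u, A' u -> r <= u 0 i) ->
  q < r -> 0 < s -> minval A D y = minval A' D y ->
  minval A D (y + s *: delta_mx 0 i) < minval A' D (y + s *: delta_mx 0 i).
Proof.
move=> clA A0 clA' A'0 Aq A'r qr s0 AA'.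
set z := y + _.
have objz u : objective D z u = objective D y u + s * u 0 i.
  by rewrite /objective /z !dotv_linear dotv_delta addrA.
have [u Au uE] := minval_attained y clA A0.
have [v A'v vE] := minval_attained z clA' A'0.
apply: le_lt_trans (minval_le z clA Au) _.
rewrite vE !objz -uE AA'.
apply: ler_ltD; first exact: minval_le.
by rewrite ltr_pM2l// (le_lt_trans (Aq _ Au))// (lt_le_trans qr)// A'r.
Qed.

(** Each minimizer is tested in the other problem; thus a minimizer at [y] is a supergradient of the
    minimal value there. *)
Lemma minval_sub_bounds y z u v :
  is_minimizer (objective D y) u -> is_minimizer (objective D z) v ->
  dotv v (z - y) <= minval setT D z - minval setT D y <= dotv u (z - y).
Proof.
move=> uP vP; rewrite (minval_minimizer uP) (minval_minimizer vP).
have := uP v; have := vP u; rewrite /objective !dotv_linear => h1 h2.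
by apply/andP; split; lra.
Qed.

End minval_theory.

(** A common minimizer is a supergradient of both minimal values, so it cancels to first order in
    their difference [G]. What remains is a monotonicity gap, which telescopes along a segment. *)
Lemma common_minimizer_sub_const D1 D2 :
  convexf D1 -> superlinear D1 -> convexf D2 -> superlinear D2 ->
  (forall y, exists u,
    is_minimizer (objective D1 y) u /\ is_minimizer (objective D2 y) u) ->
  forall a b, minval setT D1 a - minval setT D2 a =
              minval setT D1 b - minval setT D2 b.
Proof.
move=> cD1 sD1 cD2 sD2 /choice[u uP] a b.
pose G y := minval setT D1 y - minval setT D2 y.
have step y z : `|G z - G y| <= dotv (u y - u z) (z - y).
  have /andP[l1 r1] := minval_sub_bounds cD1 sD1 (uP y).1 (uP z).1.
  have /andP[l2 r2] := minval_sub_bounds cD2 sD2 (uP y).2 (uP z).2.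
  by rewrite ler_norml /G dotvBl; apply/andP; split; lra.
have grid h (k : nat) :
    `|G (a + k%:R *: h) - G a| <= dotv (u a - u (a + k%:R *: h)) h.
  elim: k => [|k IH].
    by rewrite scale0r addr0 !subrr normr0 -(scale0r h) dotvZl mul0r.
  set z := a + k.+1%:R *: h; set y := a + k%:R *: h in IH *.
  have zy : z - y = h by apply/rowP => i; rewrite !mxE -natr1; ring.
  have := step y z; rewrite zy => syz.
  rewrite -(subrKA (G y)) (le_trans (ler_normD _ _))//.
  by rewrite -(subrKA (u y)) dotvDl addrC lerD.
pose c := dotv (u a - u b) (b - a).
(* With [n.+1] equal steps the telescoped gap is paired with only one step, which yields the factor
   [n.+1]; as [c] does not depend on [n], the increment must vanish. *)
have bound (n : nat) : n.+1%:R * `|G b - G a| <= c.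
  have := grid (n.+1%:R^-1 *: (b - a)) n.+1.
  rewrite scalerA divff// scale1r (addrC a) subrK dotvZr -/c.
  by rewrite ler_pdivlMl.
apply/esym/eqP; rewrite -subr_eq0 -normr_eq0 -[_ == 0]negbK; apply/negP => Gab.
have d0 : 0 < `|G b - G a| by rewrite lt_def Gab normr_ge0.
have /archi_boundP : 0 <= `|c| / `|G b - G a| by rewrite divr_ge0.
rewrite ltr_pdivrMr// => cn.
have := bound (Num.bound (`|c| / `|G b - G a|)).
have := ler_norm c; rewrite -natr1 mulrDl mul1r; move: cn d0; lra.
Qed.

(* [- (2 * l) *: (u - u0)] is a subgradient of [D] at the proximal point [u]
   of [u0]. *)
Lemma prox_minimizer D (l : R) u0 u : convexf D -> 0 <= l ->
  (forall v, D u + l * dotv (u - u0) (u - u0) <=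
             D v + l * dotv (v - u0) (v - u0)) ->
  is_minimizer (objective D ((2 * l) *: (u - u0))) u.
Proof.
move=> cD l0 uP v; rewrite leNgt; apply/negP => vu.
set d := objective D ((2 * l) *: (u - u0)) u -
         objective D ((2 * l) *: (u - u0)) v.
have d0 : 0 < d by rewrite subr_gt0.
set N := l * dotv (v - u) (v - u).
have N0 : 0 <= N by rewrite mulr_ge0 ?dotv_ge0.
(* Moving from [u] towards [v] by [t] lowers the proximal objective by at least
   [t * d - t ^+ 2 * N]; this [t] makes that positive. *)
set t := d / (d + N).
have dN0 : 0 < d + N by lra.
have t0 : 0 < t by rewrite divr_gt0.
have t1 : t <= 1 by rewrite ler_pdivrMr// mul1r; lra.
have tN : t * N < d.
  by rewrite /t mulrAC ltr_pdivrMr// ltr_pM2l//; lra.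
have := uP (t *: v + (1 - t) *: u); have := cD t v u (ltW t0) t1.
rewrite (_ : _ + _ - u0 = (u - u0) + t *: (v - u)); last first.
  by apply/rowP => i; rewrite !mxE; ring.
rewrite (_ : dotv (_ + t *: _) _ = dotv (u - u0) (u - u0) +
  2 * t * dotv (u - u0) (v - u) + t ^+ 2 * dotv (v - u) (v - u)); last first.
  move: (u - u0) (v - u) => a b.
  by rewrite !dotv_linear (dotvC b a); ring.
have dE : d = D u - D v + 2 * l * dotv (u - u0) (u - v).
  by rewrite /d /objective !dotv_linear !(dotvC v) !(dotvC _ u0); ring.
rewrite -(opprB v u) dotvNr in dE.
move=> h1 h2; have : 0 <= t * (t * N - d).
  by rewrite dE /N; move: h1 h2; lra.
by rewrite pmulr_rge0// subr_ge0 leNgt tN.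
Qed.

(** At a proximal point [u] of [u0], some [y] has [u] as minimizer for [D1], while [u] is merely a
    competitor for [D2]; hence [D1 u - D2 u <= c]. Proximal points come arbitrarily close to [u0],
    and continuity concludes. *)
Lemma minval_sub_const D1 D2 (c : R) :
  convexf D1 -> superlinear D1 -> convexf D2 -> superlinear D2 ->
  (forall u, 0 <= D1 u) ->
  (forall y, minval setT D1 y - minval setT D2 y = c) ->
  forall u, D1 u - D2 u <= c.
Proof.
move=> cD1 sD1 cD2 sD2 D1_ge0 Dc u0; rewrite leNgt; apply/negP => cu0.
have : (D1 z - D2 z) @[z --> u0] --> D1 u0 - D2 u0.
  by apply: (@cvgB _ _ _ _ (nbhs_filter u0)); exact: convexf_continuous.
move=> /(@cvgrPdist_lt _ _ _ (nbhs u0) (nbhs_filter u0)).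
have e0 : 0 < D1 u0 - D2 u0 - c by lra.
move=> /(_ _ e0) /(@nbhs_normP R 'rV[R]_p u0)[e /= e_gt0 eP].
(* Comparing the proximal point [u] with [u0] gives [l * dotv (u - u0) (u - u0) <= D1 u0 < l * e ^+
   2], which puts [u] within [e] of [u0]. *)
pose l := (D1 u0 + 1) / e ^+ 2.
have e2 : 0 < e ^+ 2 by rewrite exprn_gt0.
have l0 : 0 < l by rewrite divr_gt0// ltr_wpDl.
(* Expanding the square shows that this objective and the proximal one differ by a constant. *)
have [||u uP] := @exists_minimizer (fun u => D1 u + l * dotv u u) _ _
    (- (2 * l) *: u0).
- by apply: convexfD => //; exact/convexf_dotv/ltW.
- by apply: superlinearD => // v; rewrite mulr_ge0 ?dotv_ge0// ltW.
have {}uP v : D1 u + l * dotv (u - u0) (u - u0) <=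
             D1 v + l * dotv (v - u0) (v - u0).
  have := uP v; rewrite /objective !dotv_linear (dotvC u0 u) (dotvC u0 v).
  lra.
have uu0 : `|u0 - u| < e.
  rewrite distrC (le_lt_trans (normr_le_enorm _))//.
  rewrite -(ger0_norm (ltW e_gt0)) -sqrtr_sqr /enorm ltr_sqrt//.
  have := uP u0; rewrite subrr dotv0l mulr0 addr0 => ul.
  rewrite -(ltr_pM2l l0) [ltRHS]divfK ?gt_eqF//.
  have := D1_ge0 u; lra.
have := eP u uu0; rewrite /= ltr_norml => /andP[_ Du].
have /(minval_minimizer cD1 sD1) m1 := prox_minimizer cD1 (ltW l0) uP.
have := Dc ((2 * l) *: (u - u0)).
have := minval_le cD2 sD2 ((2 * l) *: (u - u0)) (@closedT _) (I : setT u).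
rewrite m1 /objective; lra.
Qed.

End minimization.

(** * Borel measurability and positivity of Lebesgue measure on open sets *)

Section borel_rV.
Context {R : realType} {p : nat}.
Implicit Types (f : 'rV[R]_p -> R) (U : set 'rV[R]_p).

Lemma open_measurable_rV U : open U -> measurable U.
Proof. by move=> oU; exact: sub_sigma_algebra. Qed.

Lemma measurable_fun_open_lt f :
  (forall c, open [set y | f y < c]) -> measurable_fun setT f.
Proof.
move=> fc; apply: (measurability _ (RGenInftyO.measurableE R)).
move=> _ [_ [c ->] <-]; rewrite setTI; apply: open_measurable_rV.
rewrite (_ : _ @^-1` _ = [set y | f y < c])//.
Qed.

Lemma continuous_measurable_rV f : continuous f -> measurable_fun setT f.
Proof.
move=> cf; apply: measurable_fun_open_lt => c.
by apply: (@open_comp _ _ f [set x | x < c]) => [y _|]; [exact: cf|exact: open_lt].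
Qed.

Lemma continuous_dotv (u : 'rV[R]_p) : continuous (dotv u).
Proof.
by apply: convexf_continuous => t y z t0 t1; rewrite !dotv_linear.
Qed.

Lemma measurable_rotate (O : 'M[R]_p) : measurable_fun setT (rotate O).
Proof.
apply: measurable_fun_rVP => i.
apply: (@eq_measurable_fun _ _ _ _ _ (dotv (row i O))) => [u _|].
  by rewrite mxE; apply: eq_bigr => j _; rewrite !mxE mulrC.
exact: (continuous_measurable_rV (@continuous_dotv _)).
Qed.

HB.instance Definition _ (O : 'M[R]_p) := @isMeasurableFun.Build _ _ _ _
  (rotate O) (measurable_rotate O).

Lemma lebesgue_rV_open_neq0 U : open U -> U !=set0 -> lebesgue_rV p U != 0%E.
Proof.
move=> oU [u Uu].
have /(@nbhs_ballP R 'rV[R]_p u)[e /= e0 eU] : nbhs u U by exact: open_nbhs_nbhs.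
pose B := [set v : 'rV[R]_p | forall i, ball (u 0 i) e (v 0 i)].
have BU : B `<=` U.
  by move=> v Bv; apply: eU; split=> // i j; rewrite (ord1 i); exact: Bv.
have mB i : measurable (ball (u 0 i) e : set (measurableTypeR R)).
  exact: measurable_ball.
rewrite gt_eqF//.
have mBB : measurable B.
  rewrite (_ : B = \bigcap_(i in [set: 'I_p])
      (fun v : 'rV[R]_p => v 0 i) @^-1` ball (u 0 i) e); last first.
    by apply/seteqP; split=> [v Av i _|v Av i]; exact: Av.
  apply: fin_bigcap_measurable => [|i _]; first exact: finite_finset.
  by rewrite -[X in measurable X]setTI; apply: (measurable_coord i) => //; exact: mB.
apply: (@lt_le_trans _ _ (lebesgue_rV p B)); last first.
  apply: le_measure => //; rewrite inE; first exact: mBB.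
  exact: open_measurable_rV.
rewrite (lebesgue_rV_box mB); elim/big_ind: _ => //= [x y|i _].
  exact: mule_gt0.
by rewrite lebesgue_measure_ball ?ltW// lte_fin mulrn_wgt0.
Qed.

End borel_rV.

(** * Sets meeting every line parallel to an axis at most once *)

Section line_sections.
Context {R : realType}.

Lemma rV_cons_shift0 n (xv : measurableTypeR R * 'rV[R]_n) (s : R) :
  rV_cons xv + s *: delta_mx 0 0 = rV_cons ((xv.1 : R) + s, xv.2).
Proof.
apply/rowP => i; rewrite [LHS]mxE; case: (unliftP 0 i) => [j|] ->.
  by rewrite !rV_consS !mxE /= mulr0 addr0.
by rewrite !rV_cons0 !mxE /= mulr1.
Qed.

Lemma rV_cons_shiftS n (xv : measurableTypeR R * 'rV[R]_n) (s : R) (j : 'I_n) :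
  rV_cons xv + s *: delta_mx 0 (lift 0 j) =
  rV_cons (xv.1, xv.2 + s *: delta_mx 0 j).
Proof.
apply/rowP => i; rewrite [LHS]mxE; case: (unliftP 0 i) => [k|] ->.
  by rewrite !rV_consS !mxE /= (inj_eq lift_inj).
by rewrite !rV_cons0 !mxE /= mulr0 addr0.
Qed.

(** Induction following the construction of [lebesgue_rV], which adds coordinate 0 in front. If the
    axis is a later one, each section at a fixed first coordinate inherits the property and is null
    by induction. If it is axis 0, sections along it have at most one point. *)
Lemma lebesgue_rV_line0 p (i : 'I_p) (A : set 'rV[R]_p) : measurable A ->
  (forall y s, 0 < s -> A y -> ~ A (y + s *: delta_mx 0 i)) ->
  lebesgue_rV p A = 0%E.
Proof.
elim: p i A => [[]//|n IH i A mA Ai].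
set B := @rV_cons R n @^-1` A.
have mB : measurable B.
  by rewrite /B -[X in measurable X]setTI; exact: measurable_rV_cons.
change ((@lebesgue_measure R \x lebesgue_rV n)%E B = 0%E).
case: (unliftP 0 i) => [j|] ij; subst i.
  apply: integral0_eq => x _ /=; apply: (IH j); first exact: measurable_xsection.
  move=> v s s0; rewrite /xsection /= !inE => Bxv.
  by have := Ai _ _ s0 Bxv; rewrite rV_cons_shiftS.
(* The order of integration is exchanged, so that the inner measure is the one along axis 0. *)
rewrite (product_measure_unique
  (fun A B mA mB => product_measure2E _ _ mA mB) mB).
apply: integral0_eq => v _ /=; apply: countable_lebesgue_measure0.
have [->|/set0P[x0 Bx0]] := eqVneq (ysection B v) set0.
  exact: countable0.
apply: sub_countable (countable1 x0); apply: subset_card_le => x Bx /=.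
have gap (a b : R) : B (a, v) -> B (b, v) -> ~ a < b.
  move=> Ba Bb ab; have := Ai (rV_cons (a, v)) (b - a); rewrite subr_gt0.
  by move=> /(_ ab Ba); rewrite rV_cons_shift0 /= addrC subrK.
move: Bx Bx0; rewrite /ysection /= !inE => Bx Bx0.
by have [/(gap _ _ Bx Bx0)|/(gap _ _ Bx0 Bx)|] := ltgtP (x : R) x0.
Qed.

End line_sections.

(** * Uniqueness of the minimizer for Lebesgue-almost every [y] *)

Section unique_minimizer.
Context {R : realType} {p : nat}.
Variables (D : 'rV[R]_p -> R) (cD : convexf D) (sD : superlinear D).

(* An infimum of affine functions is upper semicontinuous. *)
Lemma measurable_minval (A : set 'rV[R]_p) : closed A -> A !=set0 ->
  measurable_fun setT (minval A D).
Proof.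
move=> clA A0; apply: measurable_fun_open_lt => c.
rewrite (_ : [set y | _] =
    \bigcup_(u in A) [set y | dotv u y < c - D u]); last first.
  apply/seteqP; split=> [y /= yc|y [u Au /= uc]].
    have [u Au uE] := minval_attained cD sD y clA A0.
    by exists u => //=; move: yc; rewrite uE /objective; lra.
  apply: le_lt_trans (minval_le cD sD y clA Au) _.
  by rewrite /objective; lra.
apply: bigcup_open => u _.
apply: (@open_comp _ _ (dotv u) [set x | x < c - D u]) => [y _|].
  exact: continuous_dotv.
exact: open_lt.
Qed.

Lemma closed_halfspace_le (i : 'I_p) (q : R) :
  closed [set u : 'rV[R]_p | u 0 i <= q].
Proof.
apply: (@closed_comp _ _ (fun u : 'rV[R]_p => u 0 i) [set x | x <= q]).
  by move=> u _; exact: coord_continuous.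
exact: closed_le.
Qed.

Lemma closed_halfspace_ge (i : 'I_p) (q : R) :
  closed [set u : 'rV[R]_p | q <= u 0 i].
Proof.
apply: (@closed_comp _ _ (fun u : 'rV[R]_p => u 0 i) [set x | q <= x]).
  by move=> u _; exact: coord_continuous.
exact: closed_ge.
Qed.

Let halfspace_tie (i : 'I_p) (q r : R) : set 'rV[R]_p :=
  [set y | minval [set u : 'rV[R]_p | u 0 i <= q] D y =
           minval [set u : 'rV[R]_p | r <= u 0 i] D y].

Lemma halfspace_tie0 (i : 'I_p) (q r : R) : q < r ->
  measurable (halfspace_tie i q r) /\
  lebesgue_rV p (halfspace_tie i q r) = 0%E.
Proof.
move=> qr.
have le0 : [set u : 'rV[R]_p | u 0 i <= q] !=set0.
  by exists (const_mx q); rewrite /= mxE.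
have ge0 : [set u : 'rV[R]_p | r <= u 0 i] !=set0.
  by exists (const_mx r); rewrite /= mxE.
have mtie : measurable (halfspace_tie i q r).
  rewrite (_ : halfspace_tie i q r = (fun y =>
      minval [set u : 'rV[R]_p | u 0 i <= q] D y ==
      minval [set u : 'rV[R]_p | r <= u 0 i] D y) @^-1` [set true]).
    rewrite -[X in measurable X]setTI; apply: measurable_fun_eqr => //.
      exact: (measurable_minval (@closed_halfspace_le i q) le0).
    exact: (measurable_minval (@closed_halfspace_ge i r) ge0).
  by apply/seteqP; split=> y /= /eqP.
split=> //; apply: (lebesgue_rV_line0 (i := i)) => // y s s0 yE yE'.
have := @minval_shift_lt _ _ _ cD sD _ _ i q r s y
  (@closed_halfspace_le i q) le0 (@closed_halfspace_ge i r) ge0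
  (fun _ h => h) (fun _ h => h) qr s0 yE.
by rewrite yE' ltxx.
Qed.

Lemma minimizers_eq_ae : exists N : set 'rV[R]_p,
  [/\ measurable N, lebesgue_rV p N = 0%E &
    forall y, ~ N y -> forall u v, is_minimizer (objective D y) u ->
      is_minimizer (objective D y) v -> u = v].
Proof.
(* The slabs are indexed by [nat] through [pickle]; codes that give no slab contribute the empty
   set. *)
pose F (k : nat) : set 'rV[R]_p :=
  if unpickle k is Some (i, q, r) then
    if (q < r :> rat)%R then halfspace_tie i (ratr q) (ratr r) else set0
  else set0.
have FP k : measurable (F k) /\ lebesgue_rV p (F k) = 0%E.
  rewrite /F; case: unpickle => [[[i q] r]|]; last by rewrite measure0.
  case: ifPn => [qr|_]; last by rewrite measure0.
  by apply: halfspace_tie0; rewrite ltr_rat.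
exists (\bigcup_k F k); split.
- by apply: bigcupT_measurable => k; exact: (FP k).1.
- apply: measure_negligible.
    by apply: bigcupT_measurable => k; exact: (FP k).1.
  apply: negligible_bigcup => k; apply/negligibleP; first exact: (FP k).1.
  exact: (FP k).2.
move=> y Ny u v; wlog : u v / exists i : 'I_p, u 0 i < v 0 i => [wl uP vP|].
  apply/rowP => i; have [uv|vu|//] := ltgtP (u 0 i) (v 0 i).
    by rewrite (wl u v)//; exists i.
  by rewrite (wl v u)//; exists i.
move=> [i uv] uP vP; exfalso; apply: Ny.
have [q] := rat_in_itvoo uv; rewrite in_itv/= => /andP[uq qv].
have [r] := rat_in_itvoo qv; rewrite in_itv/= => /andP[qr rv].
exists (pickle (i, q, r)) => //; rewrite /F pickleK -(ltr_rat R) qr /=.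
(* Each half-space contains a global minimizer, so both restricted minima equal the global one. *)
rewrite /halfspace_tie /=.
rewrite (minval_eq (A := [set w | w 0 i <= ratr q]) (ltW uq)
  (fun w _ => uP w)).
rewrite (minval_eq (A := [set w | ratr r <= w 0 i]) (ltW rv)
  (fun w _ => vP w)).
by apply/eqP; rewrite eq_le uP vP.
Qed.

End unique_minimizer.

(** * Almost sure comparison of random variables *)

Section almost_everywhere.
Context d (T : measurableType d) (R : realType).

Lemma ae_le_measure (mu : {measure set T -> \bar R}) (A B : set T) :
  measurable A -> measurable B -> {ae mu, forall w, A w -> B w} ->
  (mu A <= mu B)%E.
Proof.
move=> mA mB [N [mN N0 AB]].
have AsubBN : A `<=` B `|` N.
  move=> w Aw; have [|nBw] := pselect (B w); first by left.
  by right; apply: AB => /= /(_ Aw).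
apply: le_trans (_ : mu (B `|` N) <= _)%E.
  by apply: le_measure => //; rewrite inE//; exact: measurableU.
by rewrite (le_trans (measureU2 _ mB mN))// [X in (_ + X)%E]N0 adde0.
Qed.

Lemma measurable_fun_superlevel (X : T -> R) (c : R) :
  measurable_fun setT X -> measurable [set w | c <= X w].
Proof.
move=> mX; rewrite -[X in measurable X]setTI.
rewrite (_ : [set w | _] = X @^-1` `[c, +oo[%classic).
  by apply: mX => //; exact: measurable_itv.
by apply/seteqP; split=> w /=; rewrite in_itv/= andbT.
Qed.

(** If [X w < Z w], a rational lies in between. For each rational [q], up to a null set the event
    [q <= X] is contained in the event [q <= Z] and has at least its probability, so the difference
    is null. No integrability enters. *)
Lemma ae_eq_superlevel (P : probability T R) (X Z : T -> R) :
  measurable_fun setT X -> measurable_fun setT Z ->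
  {ae P, forall w, X w <= Z w} ->
  (forall c, P [set w | (c <= Z w)%R] <= P [set w | (c <= X w)%R])%E ->
  {ae P, forall w, X w = Z w}.
Proof.
move=> mX mZ XZ PZX.
pose F (k : nat) : set T := if unpickle k is Some q then
  [set w | ratr q <= Z w] `\` [set w | ratr q <= X w] else set0.
have F0 k : P.-negligible (F k).
  rewrite /F; case: unpickle => [q|]; last exact: negligible_set0.
  have mA := measurable_fun_superlevel (ratr q) mZ.
  have mB := measurable_fun_superlevel (ratr q) mX.
  apply/negligibleP; first exact: measurableD.
  rewrite measureD//=; last first.
    by rewrite (le_lt_trans (probability_le1 _ _))// ltry.
  suff -> : P ([set w | ratr q <= Z w] `&` [set w | ratr q <= X w]) =
            P [set w | ratr q <= Z w] by rewrite subee// fin_num_measure.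
  apply/eqP; rewrite eq_le; apply/andP; split.
    by apply: le_measure => [||w []//]; rewrite inE//; exact: measurableI.
  apply: le_trans (PZX _) _; apply: ae_le_measure => //.
    exact: measurableI.
  apply: filterS XZ => w XZw /= qX; split=> //.
  exact: le_trans XZw.
apply: (negligibleS _ (negligibleU XZ (negligible_bigcup F0))) => w /= XZw.
have [XleZ|] := pselect (X w <= Z w); last by left.
right; have : X w < Z w by rewrite lt_neqAle XleZ andbT; apply/eqP.
move=> /rat_in_itvoo[q]; rewrite in_itv/= => /andP[Xq qZ].
exists (pickle q); first exact: I.
rewrite /F pickleK; split=> /=; first exact: ltW.
by apply/negP; rewrite -ltNge.
Qed.

End almost_everywhere.

(** * From almost sure minimization to laws and to every [y] *)

Section minimizer_law.
Context d (T : measurableType d) (R : realType) (P : probability T R) (p : nat).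
Implicit Types (V Y W : {RV P >-> 'rV[R]_p}) (D : 'rV[R]_p -> R).

Lemma same_law_open (V V' : {RV P >-> 'rV[R]_p}) :
  (forall U, open U -> P (V @^-1` U) = P (V' @^-1` U)) -> same_law P V V'.
Proof.
move=> VV' A mA.
apply: (@measure_unique _ R _ (@open 'rV[R]_p) (fun=> setT) _ _ _ _
  (distribution P V) (distribution P V')) => //.
- exact: openI.
- by move=> _; exact: openT.
- by apply/seteqP; split=> // v _; exists 0%N.
- by move=> _; rewrite (le_lt_trans (probability_le1 _ _))// ltry.
Qed.

Lemma ae_distribution0 V (N : set 'rV[R]_p) : measurable N ->
  distribution P V N = 0%E -> {ae P, forall w, ~ N (V w)}.
Proof.
move=> mN N0; exists (V @^-1` N); split=> //.
  exact: measurable_funPTI.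
by move=> w /= /contrapT.
Qed.

Section convex_penalty.
Variables (D : 'rV[R]_p -> R) (cD : convexf D) (sD : superlinear D).

Lemma ae_minimizer_unique V : distribution P V `<< lebesgue_rV p ->
  {ae P, forall w, forall u v, is_minimizer (objective D (V w)) u ->
     is_minimizer (objective D (V w)) v -> u = v}.
Proof.
move=> /null_content_dominatesP Vac.
have [N [mN N0 NP]] := minimizers_eq_ae cD sD.
by apply: filterS (ae_distribution0 mN (Vac _ mN N0)) => w; exact: NP.
Qed.

Lemma measurable_minval_neq (A : set 'rV[R]_p) : closed A -> A !=set0 ->
  measurable [set y | minval A D y != minval setT D y].
Proof.
move=> clA A0.
rewrite (_ : mkset _ = (fun y =>
    minval A D y == minval setT D y) @^-1` [set false]).
  rewrite -[X in measurable X]setTI; apply: measurable_fun_eqr => //.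
    exact: measurable_minval.
  by apply: (measurable_minval cD sD (@closedT _)); exists 0.
by apply/seteqP; split=> y /=; case: eqP.
Qed.

(** If [W] is in [U] and the two minima agree, a second minimizer lies outside [U], against
    uniqueness; if [W] is outside [U], they agree because [W] attains both. The complement is
    nonempty so that its [minval] is an attained minimum. *)
Lemma minimizer_law_open Y W (U : set 'rV[R]_p) :
  distribution P Y `<< lebesgue_rV p ->
  {ae P, forall w, is_minimizer (objective D (Y w)) (W w)} ->
  open U -> ~` U !=set0 ->
  P (W @^-1` U) =
  distribution P Y [set y | minval (~` U) D y != minval setT D y].
Proof.
move=> Yac WP oU U0; have clU : closed (~` U) by exact: open_closedC.
have mtie := measurable_minval_neq clU U0.
have mW : measurable (W @^-1` U).
  by apply: measurable_funPTI; exact: open_measurable_rV.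
have mY : measurable (Y @^-1` [set y | minval (~` U) D y != minval setT D y]).
  exact: measurable_funPTI.
apply/eqP; rewrite eq_le; apply/andP.
split; apply: (@ae_le_measure _ _ _ P _ _ _ _ _) => //.
  apply: filterS2 (ae_minimizer_unique Yac) WP => w uniq Ww UW /=.
  apply/eqP => tie.
  have [u Uu uE] := minval_attained cD sD (Y w) clU U0.
  have uP : is_minimizer (objective D (Y w)) u.
    by apply/is_minimizerP => //; rewrite -tie.
  by apply: Uu; rewrite (uniq _ _ uP Ww).
apply: filterS WP => w Ww /= /eqP tie; apply: contrapT => nUW; apply: tie.
by rewrite (minval_minimizer cD sD Ww); apply: minval_eq => // v _; exact: Ww.
Qed.

End convex_penalty.

(** The points [y] without a common minimizer form an open set that is null for the law of [Y],
    hence Lebesgue-null by domination, hence empty. *)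
Lemma ae_common_minimizer D1 D2 Y :
  convexf D1 -> superlinear D1 -> convexf D2 -> superlinear D2 ->
  (forall u, 0 <= D2 u) ->
  lebesgue_rV p `<< distribution P Y ->
  {ae P, forall w, exists u, is_minimizer (objective D1 (Y w)) u /\
                             is_minimizer (objective D2 (Y w)) u} ->
  forall y, exists u,
    is_minimizer (objective D1 y) u /\ is_minimizer (objective D2 y) u.
Proof.
move=> cD1 sD1 cD2 sD2 D2_ge0 Ydom common.
(* A common minimizer exists at [y] iff the minimum for the average of [D1] and
   [D2] is the average of the minima, which is a closed condition on [y]. *)
pose E u := 2^-1 * (D1 u + D2 u).
have i20 : 0 < 2^-1 :> R by rewrite invr_gt0.
have cE : convexf E by apply: convexfZ; [exact: ltW|exact: convexfD].
have sE : superlinear E by apply: superlinearZ => //; exact: superlinearD.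
have objE y u : objective E y u = 2^-1 * (objective D1 y u + objective D2 y u).
  by rewrite /objective /E; field.
pose avg y := 2^-1 * (- minval setT D1 y + - minval setT D2 y).
pose gap y := avg y - - minval setT E y.
have cavg : continuous avg.
  apply: convexf_continuous; apply: convexfZ; first exact: ltW.
  by apply: convexfD; exact: minval_concave.
have gap_continuous : continuous gap.
  move=> y; apply: (@cvgB _ _ _ _ (nbhs_filter y)); first exact: cavg.
  exact: (convexf_continuous (minval_concave cE sE)).
have gapE y :
    gap y = minval setT E y - 2^-1 * (minval setT D1 y + minval setT D2 y).
  by rewrite /gap /avg; ring.
have open_gap : open [set y | gap y != 0].
  apply: (@open_comp _ _ gap [set x | x != 0]) => [y _|].
    exact: gap_continuous.
  exact: open_neq.
have gapY : {ae P, forall w, gap (Y w) = 0}.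
  apply: filterS common => w [u [u1 u2]].
  have uE : is_minimizer (objective E (Y w)) u.
    by move=> v; rewrite !objE; have := u1 v; have := u2 v; lra.
  rewrite gapE (minval_minimizer cE sE uE) objE.
  by rewrite (minval_minimizer cD1 sD1 u1) (minval_minimizer cD2 sD2 u2) subrr.
have gap0 y : gap y = 0.
  apply: contrapT => /eqP gy.
  have /negP := lebesgue_rV_open_neq0 open_gap (ex_intro _ y gy); apply.
  have mgap := open_measurable_rV open_gap.
  move/null_content_dominatesP: Ydom => /(_ _ mgap) -> //.
  apply: (@measure_negligible _ _ _ P); first exact: measurable_funPTI.
  by apply: negligibleS gapY => w /= /eqP.
move=> y; have [u uP] := exists_minimizer cE sE y; exists u.
(* The excesses of [u] over the two minima are nonnegative and sum to zero, so both vanish. *)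
have := gapE y; rewrite gap0 (minval_minimizer cE sE uP) objE.
have h1 := minval_le cD1 sD1 y (@closedT _) (I : setT u).
have h2 := minval_le cD2 sD2 y (@closedT _) (I : setT u).
move=> e; split; apply/is_minimizerP => //; lra.
Qed.

End minimizer_law.

(** * The laws of [Y] and [W] determine the penalty *)

Section penalty_determined_by_law.
Context d (T : measurableType d) (R : realType) (P : probability T R) (p : nat).
Implicit Types (V Y W : {RV P >-> 'rV[R]_p}) (D : 'rV[R]_p -> R).

Lemma same_law_sym (V V' : T -> 'rV[R]_p) : same_law P V V' -> same_law P V' V.
Proof. by move=> VV' A mA; rewrite VV'. Qed.

Lemma minimizer_same_law D Y1 Y2 W1 W2 : convexf D -> superlinear D ->
  distribution P Y1 `<< lebesgue_rV p ->
  {ae P, forall w, is_minimizer (objective D (Y1 w)) (W1 w)} ->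
  {ae P, forall w, is_minimizer (objective D (Y2 w)) (W2 w)} ->
  same_law P Y1 Y2 -> same_law P W1 W2.
Proof.
move=> cD sD Y1ac W1P W2P YY; apply: same_law_open => U oU.
(* When [U] is the whole space there is no complement to minimize over, and both probabilities are
   that of the full event. *)
have [U0|/set0P U0] := eqVneq (~` U) set0.
  by rewrite -[U]setCK U0 setC0 !preimage_setT.
have Y2ac : distribution P Y2 `<< lebesgue_rV p.
  apply/null_content_dominatesP => A mA A0.
  rewrite [LHS](esym (YY A mA)).
  by move/null_content_dominatesP: Y1ac; exact.
rewrite (minimizer_law_open cD sD Y1ac W1P oU U0).
rewrite (minimizer_law_open cD sD Y2ac W2P oU U0).
apply: YY; apply: (measurable_minval_neq cD sD _ U0); exact: open_closedC.
Qed.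

Lemma ae_minimizer_common D1 D2 Y1 Y2 W1 W2 :
  convexf D1 -> superlinear D1 -> convexf D2 -> superlinear D2 ->
  {ae P, forall w, is_minimizer (objective D1 (Y1 w)) (W1 w)} ->
  {ae P, forall w, is_minimizer (objective D2 (Y2 w)) (W2 w)} ->
  same_law P Y1 Y2 -> same_law P W1 W2 ->
  {ae P, forall w, is_minimizer (objective D2 (Y1 w)) (W1 w)}.
Proof.
move=> cD1 sD1 cD2 sD2 W1P W2P YY WW.
pose F u := D1 u - D2 u.
pose G y := minval setT D1 y - minval setT D2 y.
have mF : measurable_fun setT F.
  by apply: measurable_funB; apply: continuous_measurable_rV;
    exact: convexf_continuous.
have T0 : [set: 'rV[R]_p] !=set0 by exists 0.
have mG : measurable_fun setT G.
  by apply: measurable_funB; exact: (measurable_minval _ _ (@closedT _) T0).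
have FG : {ae P, forall w, F (W1 w) <= G (Y1 w)}.
  apply: filterS W1P => w /(minval_minimizer cD1 sD1) e1.
  have := minval_le cD2 sD2 (Y1 w) (@closedT _) (I : setT (W1 w)).
  by rewrite /F /G e1 /objective; lra.
have GF : {ae P, forall w, G (Y2 w) <= F (W2 w)}.
  apply: filterS W2P => w /(minval_minimizer cD2 sD2) e2.
  have := minval_le cD1 sD1 (Y2 w) (@closedT _) (I : setT (W2 w)).
  by rewrite /F /G e2 /objective; lra.
have mFW V : measurable_fun setT (F \o V) by exact: measurableT_comp.
have mGY V : measurable_fun setT (G \o V) by exact: measurableT_comp.
have FGE : {ae P, forall w, F (W1 w) = G (Y1 w)}.
  (* The tails of [G (Y1 w)] are those of [G (Y2 w)], bounded by those of [F (W2 w)], which are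
     those of [F (W1 w)]. *)
  apply: (ae_eq_superlevel (mFW W1) (mGY Y1) FG) => c.
  have -> : P [set w | c <= G (Y1 w)] = P [set w | c <= G (Y2 w)].
    exact: (YY _ (measurable_fun_superlevel c mG)).
  have -> : P [set w | c <= F (W1 w)] = P [set w | c <= F (W2 w)].
    exact: (WW _ (measurable_fun_superlevel c mF)).
  apply: (@ae_le_measure _ _ _ P).
  - exact: (measurable_fun_superlevel c (mGY Y2)).
  - exact: (measurable_fun_superlevel c (mFW W2)).
  - by apply: filterS GF => w GFw /= /le_trans; exact.
apply: filterS2 W1P FGE => w /(minval_minimizer cD1 sD1) e1.
(* The contribution of [D1] cancels in the equality, leaving that [W1 w] attains the minimum for
   [D2]. *)
rewrite /F /G e1 /objective => e; apply/is_minimizerP => //.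
by rewrite /objective; lra.
Qed.

Lemma penalty_eq D1 D2 Y1 Y2 W1 W2 :
  convexf D1 -> superlinear D1 -> convexf D2 -> superlinear D2 ->
  (forall u, 0 <= D1 u) -> (forall u, 0 <= D2 u) -> D1 0 = D2 0 ->
  lebesgue_rV p `<< distribution P Y1 ->
  {ae P, forall w, is_minimizer (objective D1 (Y1 w)) (W1 w)} ->
  {ae P, forall w, is_minimizer (objective D2 (Y2 w)) (W2 w)} ->
  same_law P Y1 Y2 -> same_law P W1 W2 -> forall u, D1 u = D2 u.
Proof.
move=> cD1 sD1 cD2 sD2 D1_ge0 D2_ge0 D120 Ydom W1P W2P YY WW.
have common := ae_minimizer_common cD1 sD1 cD2 sD2 W1P W2P YY WW.
have {}common : forall y, exists u,
    is_minimizer (objective D1 y) u /\ is_minimizer (objective D2 y) u.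
  apply: (ae_common_minimizer cD1 sD1 cD2 sD2 D2_ge0 Ydom).
  by apply: filterS2 W1P common => w W1w W2w; exists (W1 w).
have Gc := common_minimizer_sub_const cD1 sD1 cD2 sD2 common.
have le12 := minval_sub_const cD1 sD1 cD2 sD2 D1_ge0 (fun y => Gc y 0).
have Gc' y : minval setT D2 y - minval setT D1 y =
    - (minval setT D1 0 - minval setT D2 0) by rewrite -(Gc y 0) opprB.
have le21 := minval_sub_const cD2 sD2 cD1 sD1 D2_ge0 Gc'.
(* The two bounds are opposite constants; at 0, where the penalties agree, both are nonnegative, so
   both are zero. *)
move=> u; have := le12 u; have := le21 u; have := le12 0; have := le21 0.
by rewrite D120; lra.
Qed.

Lemma rotate_minimizer D (O : 'M[R]_p) y u : orthogonal_mx O ->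
  is_minimizer (objective D y) u ->
  is_minimizer (objective (D \o rotate O^T) (rotate O y)) (rotate O u).
Proof.
move=> oO uP v; rewrite -(rotateTK oO v) /objective /= !dotv_rotate//.
by rewrite !rotateK//; exact: uP.
Qed.

(** One direction compares [D] with its rotated copy through [penalty_eq]. In the other the copy is
    [D] itself, so [W] and its rotation minimize the same penalty at vectors of equal law. *)
Lemma rotate_same_law_iff D (O : 'M[R]_p) Y W :
  convexf D -> superlinear D -> (forall u, 0 <= D u) -> orthogonal_mx O ->
  distribution P Y `<< lebesgue_rV p -> lebesgue_rV p `<< distribution P Y ->
  {ae P, forall w, is_minimizer (objective D (Y w)) (W w)} ->
  same_law P (fun w => rotate O (Y w)) Y ->
  same_law P (fun w => rotate O (W w)) W <-> forall u, D (rotate O u) = D u.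
Proof.
move=> cD sD D_ge0 oO Yac Ydom WP YO.
have OWP : {ae P, forall w, is_minimizer
    (objective (D \o rotate O^T) (rotate O (Y w))) (rotate O (W w))}.
  by apply: filterS WP => w; exact: rotate_minimizer.
split=> [WO u|DO].
  have DE := @penalty_eq D (D \o rotate O^T) Y (rotate O \o Y) W (rotate O \o W)
    cD sD (convexf_rotate _ cD)
    (superlinear_rotate (orthogonal_trmx oO) sD)
    D_ge0 (fun u => D_ge0 _) _ Ydom WP OWP
    (same_law_sym YO) (same_law_sym WO).
  by rewrite DE /= ?rotateK// rotate0.
apply: same_law_sym.
apply: (@minimizer_same_law D Y (rotate O \o Y) W (rotate O \o W)) => //.
  apply: filterS OWP => w.
  by rewrite (_ : D \o rotate O^T = D)//; apply/funext => u /=;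
    rewrite -[RHS](congr1 D (rotateTK oO u)) DO.
exact: same_law_sym.
Qed.

End penalty_determined_by_law.

(** * Negation and sign flips as orthogonal matrices *)

Section symmetries_as_rotations.
Context {R : realType} {p : nat}.
Implicit Types u : 'rV[R]_p.

Lemma orthogonal_opp1 : orthogonal_mx (- 1%:M : 'M[R]_p).
Proof.
by rewrite /orthogonal_mx linearN /= trmx1 mulmxN mulNmx mulmx1 opprK.
Qed.

Lemma rotate_opp1 u : rotate (- 1%:M) u = - u.
Proof. by rewrite /rotate linearN /= trmx1 mulmxN mulmx1. Qed.

Lemma orthogonal_sign (s : 'I_p -> R) : sign_vector s ->
  orthogonal_mx (diag_mx (\row_i s i)).
Proof.
move=> sP; rewrite /orthogonal_mx tr_diag_mx mulmx_diag.
rewrite (_ : \row__ _ = const_mx 1) ?diag_const_mx//.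
apply/rowP => i; rewrite !mxE.
by case: (sP i) => ->; rewrite ?mulr1// mulrNN mulr1.
Qed.

Lemma rotate_sign (s : 'I_p -> R) u :
  rotate (diag_mx (\row_i s i)) u = flip s u.
Proof.
rewrite /rotate tr_diag_mx mul_mx_diag.
by apply/rowP => i; rewrite !mxE mulrC.
Qed.

End symmetries_as_rotations.

Theorem theorem4p7 (R : realType) (p : nat)
    (D : 'rV[R]_p -> R)
    (D_ge0 : forall u, 0 <= D u)
    (D_convex : convex_function [set: convex_lmodType 'rV[R]_p] D)
    (D0 : D 0 = 0)
    (D_superlinear : superlinear D)
    (d : measure_display) (T : measurableType d) (P : probability T R)
    (Y : {RV P >-> 'rV[R]_p})
    (Y_mean0 : mean_zero P Y)
    (Y_ac : distribution P Y `<< lebesgue_rV p)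
    (Y_dom : lebesgue_rV p `<< distribution P Y) :
  {ae P, forall w, exists! u, is_minimizer (objective D (Y w)) u} /\
  forall W : {RV P >-> 'rV[R]_p},
    {ae P, forall w, is_minimizer (objective D (Y w)) (W w)} ->
    [/\ centrally_symmetric P Y ->
          (centrally_symmetric P W <-> even_function D),
        spherically_symmetric P Y ->
          (spherically_symmetric P W <-> rotation_invariant D) &
        sign_symmetric P Y ->
          (sign_symmetric P W <-> sign_invariant D)].
Proof.
have cD := convexfP D_convex.
split.
  apply: filterS (ae_minimizer_unique cD D_superlinear Y_ac) => w uniq.
  have [u uP] := exists_minimizer cD D_superlinear (Y w).
  by exists u; split=> // v; exact: uniq.
move=> W WP.
have rotP O (oO : orthogonal_mx O) := @rotate_same_law_iff _ _ _ P _ D O Y W cD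
  D_superlinear D_ge0 oO Y_ac Y_dom WP.
split=> [Ysym|Ysym|Ysym].
- have oppE (V : T -> 'rV[R]_p) :
      (fun w => rotate (- 1%:M) (V w)) = (fun w => - V w).
    by apply/funext => w; rewrite rotate_opp1.
  (* Central symmetry lists the vector before its negative, the reverse of the order in [rotP],
     hence the uses of [same_law_sym]. *)
  have := rotP _ orthogonal_opp1; rewrite !oppE => /(_ (same_law_sym Ysym)).
  move=> [WD DW]; split=> [Wsym u|Deven].
    by rewrite -rotate_opp1; apply: WD; exact: same_law_sym.
  by apply/same_law_sym/DW => u; rewrite rotate_opp1.
- by split=> sym O oO; have [WD DW] := rotP O oO (Ysym O oO);
    [apply: WD|apply: DW]; exact: sym.
- have flipE s (V : T -> 'rV[R]_p) :
      (fun w => rotate (diag_mx (\row_i s i)) (V w)) = (fun w => flip s (V w)).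
    by apply/funext => w; rewrite rotate_sign.
  split=> sym s ss; have := rotP _ (orthogonal_sign ss);
    rewrite !flipE => /(_ (Ysym s ss)) [WD DW].
    by move=> u; rewrite -rotate_sign; apply: WD; exact: sym.
  by apply: DW => u; rewrite rotate_sign; exact: sym.
Qed.
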